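(* Let $G=(V,A)$ be a flow graph with start vertex $s$ and dominator tree $D$, and let $T$ be a rooted tree whose vertex set is a subset of $V$. If $T$ has the parent property and has a preorder that is low-high on $G$, then $T$ has the sibling property, and hence $T=D$.
   Context: A flow graph is a finite directed graph $G=(V,A)$ with a designated start vertex $s$ such that every vertex is reachable from $s$; throughout, there are no arcs entering $s$ and $|V|>1$. A vertex $v$ dominates $w$ if every path from $s$ to $w$ contains $v$. The dominator tree $D$ is the tree rooted at $s$ on $V$ in which $v$ is an ancestor of $w$ iff $v$ dominates $w$. For a rooted tree $T$, $t(v)$ denotes the parent of $v$; ancestors and descendants include the vertex itself. $T$ has the parent property if for every arc $(v,w)\in A$, $t(w)$ is an ancestor of $v$ in $T$. $T$ has the sibling property if for all siblings $v,w$ in $T$, $v$ does not dominate $w$. A preorder of $T$ is a total order of its vertices such that for every vertex $v$, the descendants of $v$ are ordered consecutively with $v$ first. A preorder of $T$ is low-high on $G$ if for every $v\neq s$, either $(t(v),v)\in A$, or there are two arcs $(u,v),(w,v)\in A$ with $u<v<w$ in the order and $w$ not a descendant of $v$ in $T$. *)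

(* Defs.v *)
From HB Require Import structures.
From mathcomp Require Import all_boot.

Set Implicit Arguments.
Unset Strict Implicit.
Unset Printing Implicit Defensive.

(* Self-loops are allowed. *)
Definition flow_graph (V : finType) (A : rel V) (s : V) : Prop :=
  [/\ forall v, connect A s v, forall v, ~~ A v s & 1 < #|V|].

Definition dominates (V : finType) (A : rel V) (s v w : V) : Prop :=
  forall p : seq V, path A s p -> last s p = w -> v \in s :: p.

(* The parent of v is None exactly when v is the root or lies outside the tree.
   The condition is boolean and the data are finite, so that Leibniz equality
   of rooted trees is equality of vertex sets, roots and parent functions. *)
Definition is_rooted_tree (V : finType) (X : {set V}) (r : V)
    (t : {ffun V -> option V}) : bool :=
  [&& r \in X,
      [forall v, (t v != None) == (v \in X) && (v != r)],
      [forall v, forall u, (t v == Some u) ==> (u \in X)] &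
      [forall v in X, connect (fun x y => t x == Some y) v r]].

Record rooted_tree (V : finType) := RootedTree {
  tree_verts : {set V};
  tree_root : V;
  tree_parent : {ffun V -> option V};
  tree_axiom : is_rooted_tree tree_verts tree_root tree_parent
}.

Definition ancestor (V : finType) (T : rooted_tree V) (v w : V) : bool :=
  (w \in tree_verts T) && connect (fun x y => tree_parent T x == Some y) w v.

Definition descendants (V : finType) (T : rooted_tree V) (v : V) : {set V} :=
  [set w | ancestor T v w].

Definition siblings (V : finType) (T : rooted_tree V) (v w : V) : Prop :=
  v <> w /\ exists u, tree_parent T v = Some u /\ tree_parent T w = Some u.

Definition is_dominator_tree (V : finType) (A : rel V) (s : V)
    (D : rooted_tree V) : Prop :=
  [/\ tree_verts D = [set: V], tree_root D = s &
      forall v w, ancestor D v w <-> dominates A s v w].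

(* In particular the parent of w is defined for every arc (v, w), and v is a
   vertex of T. *)
Definition parent_property (V : finType) (A : rel V) (T : rooted_tree V) :
    Prop :=
  forall v w, A v w -> exists2 u, tree_parent T w = Some u & ancestor T u v.

Definition sibling_property (V : finType) (A : rel V) (s : V)
    (T : rooted_tree V) : Prop :=
  forall v w, siblings T v w -> ~ dominates A s v w.

(* A total order of the vertices of T is given by listing them increasingly. *)
Definition preorder (V : finType) (T : rooted_tree V) (o : seq V) : Prop :=
  [/\ uniq o, o =i tree_verts T &
      forall v, v \in tree_verts T ->
        exists o1 o2 o3, o = o1 ++ (v :: o2) ++ o3 /\
                         v :: o2 =i descendants T v].

Definition precedes (V : finType) (o : seq V) (u v : V) : bool :=
  [&& u \in o, v \in o & index u o < index v o].

Definition low_high (V : finType) (A : rel V) (s : V) (T : rooted_tree V)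
    (o : seq V) : Prop :=
  forall v, v <> s ->
    (exists2 u, tree_parent T v = Some u & A u v) \/
    (exists u w, [/\ A u v, A w v, precedes o u v, precedes o v w &
                     ~~ ancestor T v w]).

Section DominatorTreeExists.

Variables (V : finType) (A : rel V) (s : V).
Hypothesis reach : forall v, connect A s v.

Let domb v w := (v == s) || ~~ connect [rel x y | A x y && (y != v)] s w.

Let avoidE v x p :
  path [rel x y | A x y && (y != v)] x p = path A x p && (v \notin p).
Proof.
elim: p x => [|y p IH] x //=.
by rewrite IH inE negb_or eq_sym -!andbA; do !bool_congr.
Qed.

Let dombP v w : reflect (dominates A s v w) (domb v w).
Proof.
rewrite /domb; case: eqVneq => [->|nvs] /=.
  by apply: ReflectT => p _ _; rewrite mem_head.
apply: (iffP negP) => [nc p Ap lp|dom /connectP[p]].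
  rewrite inE (negPf nvs) /=; case: (boolP (v \in p)) => // nvp; case: nc.
  by apply/connectP; exists p => //; rewrite avoidE Ap.
rewrite avoidE => /andP[Ap nvp] lp; have := dom p Ap (esym lp).
by rewrite inE (negPf nvs) (negPf nvp).
Qed.

Let dom_refl v : dominates A s v v.
Proof. by move=> p _ <-; exact: mem_last. Qed.

Let upath w : exists p, [/\ path A s p, last s p = w & uniq (s :: p)].
Proof.
case/connectP: (reach w) => p Ap ->; case: (shortenP Ap) => q Aq uq _.
by exists q.
Qed.

Let split_at v x p : path A x p -> v \in x :: p ->
  exists p1 p2, [/\ p = p1 ++ p2, path A x p1, last x p1 = v, path A v p2 &
                    last v p2 = last x p].
Proof.
move=> + vp; case: (splitPl vp) => p1 p2 lp1; rewrite cat_path lp1 last_cat lp1.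
by case/andP=> Ap1 Ap2; exists p1, p2.
Qed.

Let dom_trans v u w :
  dominates A s v u -> dominates A s u w -> dominates A s v w.
Proof.
move=> dvu duw p Ap lp.
have [p1 [p2 [-> Ap1 lp1 _ _]]] := split_at Ap (duw p Ap lp).
by rewrite -cat_cons mem_cat (dvu p1 Ap1 lp1).
Qed.

Let dom_anti u v : dominates A s u v -> dominates A s v u -> u = v.
Proof.
move=> duv dvu; have [p [Ap lp up]] := upath v.
have [p1 [p2 [ep Ap1 lp1 _ lp2]]] := split_at Ap (duv p Ap lp).
have vin := dvu p1 Ap1 lp1.
move: up lp2; rewrite lp ep -cat_cons cat_uniq => /and3P[_ /hasPn h _].
case/lastP: p2 h {ep} => [|q x] h //=; rewrite last_rcons => xv.
by have := h x; rewrite mem_rcons mem_head xv vin => /(_ isT).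
Qed.

Let dom_chain u v w : dominates A s u w -> dominates A s v w ->
  dominates A s u v \/ dominates A s v u.
Proof.
move=> duw dvw; have [p [Ap lp up]] := upath w.
have [p1 [p2 [ep Ap1 lp1 Ap2 lp2]]] := split_at Ap (duw p Ap lp).
have mix x y q r : path A s q -> last s q = y -> path A y r ->
    last y r = w -> x \notin r -> dominates A s x w -> x \in s :: q.
  move=> Aq lq Ar lr nxr dxw; have := dxw (q ++ r).
  rewrite cat_path Aq lq Ar last_cat lq lr => /(_ isT erefl).
  by rewrite -cat_cons mem_cat (negPf nxr) orbF.
rewrite lp in lp2.
move: up; rewrite ep -cat_cons cat_uniq => /and3P[_ /hasPn h _].
case: (boolP (v \in p2)) => [vp2|nvp2]; last first.
  by right=> q Aq lq; exact: (mix v u q p2).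
left=> q Aq lq.
have vp2' : v \in u :: p2 by rewrite inE vp2 orbT.
have [r1 [r2 [er _ _ Ar2 lr2]]] := split_at Ap2 vp2'.
apply: (mix u v q r2) => //; first by rewrite lr2.
apply/negP => ur2; have := h u; rewrite er mem_cat ur2 orbT => /(_ isT).
by rewrite -lp1 mem_last.
Qed.

Let doms w := [set v | domb v w].

Let sdom v w := (v != w) && domb v w.

Let sdom_card v w : sdom v w -> #|doms v| < #|doms w|.
Proof.
case/andP=> nvw /dombP dvw; apply: proper_card; apply/properP; split.
  apply/subsetP=> x; rewrite !inE => /dombP dxv; apply/dombP.
  exact: dom_trans dvw.
exists w; rewrite !inE; first exact/dombP.
by apply: contra nvw => /dombP dwv; apply/eqP/dom_anti.
Qed.

Let idom : {ffun V -> option V} :=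
  [ffun w => [pick u | sdom u w && [forall v, sdom v w ==> domb v u]]].

Let domsE v : dominates A s v s -> v = s.
Proof. by move/(_ [::] isT erefl); rewrite inE => /eqP. Qed.

Let idomP w u : idom w = Some u ->
  sdom u w /\ forall v, sdom v w -> dominates A s v u.
Proof.
rewrite ffunE; case: pickP => // x /andP[sx /forallP h] [<-]; split=> // v sv.
by apply/dombP; have := h v; rewrite sv.
Qed.

Let idom_some w : w != s -> exists u, idom w = Some u.
Proof.
move=> nws; have sw : sdom s w by rewrite /sdom eq_sym nws /domb eqxx.
rewrite ffunE; case: pickP => [u _|none]; first by exists u.
case: (@arg_maxnP V s (sdom^~ w) (fun u => #|doms u|) sw) => u su umax.
have := none u; rewrite su /= => /negP[]; apply/forallP=> v; apply/implyP=> sv.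
have [/andP[_ /dombP du] /andP[_ /dombP dv]] := (su, sv).
have [|duv] := dom_chain dv du; first by move/dombP.
have [->|nuv] := eqVneq u v; first exact/dombP.
have := umax v sv; rewrite /= leqNgt sdom_card // /sdom nuv; exact/dombP.
Qed.

Let idom_s : idom s = None.
Proof.
case E: (idom s) => [u|] //; have [/andP[nus /dombP dus] _] := idomP E.
by rewrite (domsE dus) eqxx in nus.
Qed.

Let idom_connect v w :
  connect (fun x y => idom x == Some y) w v <-> dominates A s v w.
Proof.
split=> [/connectP[p]|].
  elim: p w => [|x p IH] w /= => [_ -> //|/andP[/eqP wx px] lp].
  by have [/andP[_ /dombP dxw] _] := idomP wx; apply: dom_trans (IH x px lp) dxw.
have [n] := ubnP #|doms w|; elim: n w => // n IH w ltn dvw.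
have [->|nvw] := eqVneq v w; first exact: connect0.
have [ws|nws] := eqVneq w s.
  by move: nvw dvw; rewrite ws => /eqP nvs /domsE.
have [u wu] := idom_some nws; have [sdu h] := idomP wu.
have sv : sdom v w by rewrite /sdom nvw; exact/dombP.
apply: (connect_trans (connect1 _)); first exact/eqP/wu.
by apply: IH (h v sv); apply: leq_trans (sdom_card sdu) _.
Qed.

Let idom_tree : is_rooted_tree [set: V] s idom.
Proof.
apply/and4P; split; first by rewrite inE.
- apply/forallP=> v; rewrite inE /=; have [->|nvs] := eqVneq v s.
    by rewrite idom_s.
  by have [u ->] := idom_some nvs.
- by apply/forallP=> v; apply/forallP=> u; rewrite inE implybT.
- apply/forallP=> v; apply/implyP=> _; apply/idom_connect.
  by move=> p _ _; rewrite mem_head.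
Qed.

Lemma dominator_tree_exists : exists D, is_dominator_tree A s D.
Proof.
exists (RootedTree idom_tree); split=> // v w.
by rewrite /ancestor inE; exact: idom_connect.
Qed.

End DominatorTreeExists.

(* Main.v *)
Require Import Defs.
From mathcomp Require Import all_boot.

(** By the parent property, an arc entering the subtree of [v] from outside
    enters it at [v] itself, so ancestors in [T] are dominators.  Conversely, if
    [v] is not an ancestor of [w], then [w] is reached while avoiding [v] by
    tracing suitable arcs backwards.  A vertex that comes before [v] is entered
    from its parent or from a lower vertex, hence again from a vertex before [v].
    A vertex that comes after the subtree of [v] is entered from its parent or
    from a vertex that comes after its own subtree; this moves backwards in
    postorder among the vertices after the subtree of [v] until it reaches a
    vertex before [v].  So ancestry in [T] is dominance, which determines [T]. *)

Set Implicit Arguments.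
Unset Strict Implicit.
Unset Printing Implicit Defensive.

(** * Ancestry in a rooted tree *)

Section RootedTree.

Variables (V : finType) (T : rooted_tree V).
Implicit Types u v w : V.

Lemma tree_parent_neqNone v :
  (tree_parent T v != None) = (v \in tree_verts T) && (v != tree_root T).
Proof. by have /and4P[_ /forallP/(_ v)/eqP] := tree_axiom T. Qed.

Lemma tree_parent_in v u : tree_parent T v = Some u -> v \in tree_verts T.
Proof.
by move=> vu; have := tree_parent_neqNone v; rewrite vu => /esym/andP[].
Qed.

Lemma tree_parent_root : tree_parent T (tree_root T) = None.
Proof.
by have := tree_parent_neqNone (tree_root T); rewrite eqxx andbF => /eqP.
Qed.

Lemma ancestor_refl v : v \in tree_verts T -> ancestor T v v.
Proof. by move=> vT; rewrite /ancestor vT connect0. Qed.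

Lemma ancestor_root v : v \in tree_verts T -> ancestor T (tree_root T) v.
Proof.
move=> vT; rewrite /ancestor vT.
by have /and4P[_ _ _ /forall_inP] := tree_axiom T; apply.
Qed.

Lemma ancestor_parent v w u :
  tree_parent T w = Some u -> ancestor T v u -> ancestor T v w.
Proof.
move=> wu /andP[_ uv]; rewrite /ancestor (tree_parent_in wu).
by apply: connect_trans uv; apply/connect1/eqP.
Qed.

Lemma ancestor_trans u v w :
  ancestor T u v -> ancestor T v w -> ancestor T u w.
Proof.
by case/andP=> _ vu /andP[wT wv]; rewrite /ancestor wT (connect_trans wv).
Qed.

Lemma parent_ancestor w u : tree_parent T w = Some u -> ancestor T u w.
Proof.
by move=> wu; rewrite /ancestor (tree_parent_in wu) connect1 //; apply/eqP.
Qed.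

Lemma tree_parent_img w u : tree_parent T w = Some u -> u \in tree_verts T.
Proof.
move/eqP=> wu; have /and4P[_ _ /forallP/(_ w)/forallP/(_ u)] := tree_axiom T.
by rewrite wu.
Qed.

Lemma ancestor_in v w : ancestor T v w -> v \in tree_verts T.
Proof.
case/andP=> wT /connectP[p]; case/lastP: p => [_ -> //|p x].
by rewrite last_rcons rcons_path => /andP[_ /eqP/tree_parent_img xT] ->.
Qed.

Lemma ancestor_parent_inv v w u :
  ancestor T v w -> v != w -> tree_parent T w = Some u -> ancestor T v u.
Proof.
case/andP=> _ /connectP[[|x p] /=]; first by move=> _ -> /eqP.
case/andP=> /eqP wx xp -> _; rewrite wx => -[<-].
by rewrite /ancestor (tree_parent_img wx); apply/connectP; exists p.
Qed.

(** A vertex that is its own parent would trap the parent chain that leads to the root, and the root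
    has no parent. *)
Lemma tree_parent_neq w u : tree_parent T w = Some u -> u != w.
Proof.
move=> wu; apply/eqP=> uw; move: wu; rewrite uw => ww.
have /andP[_ /connectP[p wp rE]] := ancestor_root (tree_parent_in ww).
suff lw : last w p = w.
  by have := tree_parent_root; rewrite rE lw ww.
elim: p wp {rE} => //= x p IHp /andP[/eqP]; rewrite ww => -[<-]; exact: IHp.
Qed.

Lemma ancestor_of_root v : ancestor T v (tree_root T) -> v = tree_root T.
Proof.
by case/andP=> _ /connectP[[|x p] //=]; rewrite tree_parent_root.
Qed.

(** * Positions in a preorder *)

Section Preorder.

Variable o : seq V.
Hypothesis preT : preorder T o.

(** Consecutive descendants become arithmetic on positions. A [w] outside [o] has index [size o],
    which lies beyond every such interval. *)
Lemma preorder_interval v w : v \in tree_verts T ->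
  ancestor T v w = (index v o <= index w o < index v o + #|descendants T v|).
Proof.
have [uo _ intv] := preT.
move=> vT; have [o1 [o2 [o3 [oE dE]]]] := intv v vT.
have wdE : ancestor T v w = (w \in v :: o2) by rewrite dE inE.
move: uo; rewrite oE !cat_uniq has_cat negb_or.
case/and3P=> _ /andP[d1 _] /and3P[u2 _ _].
have vo1 : v \notin o1 by move: d1; rewrite /= negb_or => /andP[].
rewrite -(eq_card dE) (card_uniqP u2) wdE !index_cat (negPf vo1) mem_head.
rewrite [index v (_ :: _)]/= eqxx addn0.
have [w1|nw1] := boolP (w \in o1).
  rewrite leqNgt index_mem w1 /=.
  by apply/negbTE; apply: contraL w1 => w2; apply: (hasPn d1).
rewrite leq_addr ltn_add2l; case: ifP; first by rewrite index_mem.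
by rewrite ltnNge leq_addr.
Qed.

Lemma ancestor_index v w : ancestor T v w -> index v o <= index w o.
Proof.
by move=> vw; move: (vw); rewrite preorder_interval ?(ancestor_in vw) // => /andP[].
Qed.

Lemma preorder_index_inj v w : v \in tree_verts T -> w \in tree_verts T ->
  index v o = index w o -> v = w.
Proof. by have [_ oT _] := preT; rewrite -!oT; exact: (index_inj v). Qed.

Lemma ancestor_anti v w : ancestor T v w -> ancestor T w v -> v = w.
Proof.
move=> vw wv; apply: preorder_index_inj.
- exact: ancestor_in vw.
- exact: ancestor_in wv.
- by apply/eqP; rewrite eqn_leq !ancestor_index.
Qed.

Lemma tree_parent_index w u : tree_parent T w = Some u -> index u o < index w o.
Proof.
move=> wu; have uw := parent_ancestor wu.
rewrite ltnNge; apply: contraNN (tree_parent_neq wu) => le_wu.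
apply/eqP/preorder_index_inj.
- exact: tree_parent_img wu.
- exact: tree_parent_in wu.
- by apply/eqP; rewrite eqn_leq le_wu ancestor_index.
Qed.

Lemma descendant_lt_after v x w : v \in tree_verts T ->
    ancestor T v x -> ~~ ancestor T v w -> index v o < index w o ->
  index x o < index w o.
Proof.
move=> vT; rewrite !preorder_interval // => /andP[_ ltx] + ltvw.
by rewrite (ltnW ltvw) -leqNgt; exact: leq_trans.
Qed.

End Preorder.

End RootedTree.

Lemma eq_rooted_tree (V : finType) (S T : rooted_tree V) :
    tree_verts S = tree_verts T -> tree_root S = tree_root T ->
  tree_parent S = tree_parent T -> S = T.
Proof.
case: S T => [X r t aS] [X' r' t' aT] /= EX Er Et.
case: X' / EX aT; case: r' / Er; case: t' / Et => aT.
by rewrite (bool_irrelevance aS aT).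
Qed.

(** Extending a path to [u] by the arc adds only [w], so domination passes backwards along arcs. *)
Lemma dominates_pred (V : finType) (A : rel V) (s v u w : V) :
  A u w -> v != w -> dominates A s v w -> dominates A s v u.
Proof.
move=> uw nvw dvw p sp lp; have := dvw (rcons p w).
rewrite rcons_path sp lp uw last_rcons -rcons_cons mem_rcons inE (negPf nvw).
exact.
Qed.

(** * Consequences of the parent property *)

Section FlowGraphTree.

Variables (V : finType) (A : rel V) (s : V) (T : rooted_tree V).
Hypothesis hG : flow_graph A s.
Hypothesis hpar : parent_property A T.

Lemma flow_graph_in_arc w : w != s -> exists u, A u w.
Proof.
move=> nws; have [conn _ _] := hG; have /connectP[p] := conn w.
case/lastP: p => [_ /= ws|p x]; first by rewrite ws eqxx in nws.
by rewrite rcons_path last_rcons => /andP[_ Ax] ->; exists (last s p).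
Qed.

Lemma flow_graph_out_arc : exists w, A s w.
Proof.
have [conn _ /card_gt1P[x [y [_ _ nxy]]]] := hG.
have [w nws] : exists w, w != s.
  by have [xs|] := eqVneq x s; [exists y; rewrite -xs eq_sym | exists x].
have /connectP[[/= _ ws|z p /= /andP[sz _] _]] := conn w; last by exists z.
by rewrite ws eqxx in nws.
Qed.

(** Every vertex is an end of some arc, [s] as a tail, and the parent property puts both ends of an
    arc in [T]. *)
Lemma parent_property_verts : tree_verts T = [set: V].
Proof.
apply/setP=> w; rewrite inE; have [->|/flow_graph_in_arc[u]] := eqVneq w s.
  by have [x /hpar[u _ /andP[]]] := flow_graph_out_arc.
by case/hpar=> t /tree_parent_in.
Qed.

Lemma parent_property_root : tree_root T = s.
Proof.
apply/eqP/negPn/negP => /flow_graph_in_arc[u] /hpar[t].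
by rewrite tree_parent_root.
Qed.

Let inT v : v \in tree_verts T.
Proof. by rewrite parent_property_verts inE. Qed.

Lemma ancestor_dominates v w : ancestor T v w -> dominates A s v w.
Proof.
move=> + p; elim/last_ind: p w => [|p x IHp] w vw.
  move=> _ /= sw; move: vw; rewrite -sw -parent_property_root.
  by move/ancestor_of_root->; exact: mem_head.
rewrite rcons_path last_rcons -rcons_cons mem_rcons inE => /andP[sp Ax] xw.
move: Ax; rewrite xw; have [->//|nvw] := eqVneq v w.
(* As [w] differs from [v], its parent still descends from [v], and so does the tail of the arc. *)
case/hpar=> u wu ul; apply: (IHp (last s p)) => //.
exact: ancestor_trans (ancestor_parent_inv vw nvw wu) ul.
Qed.

(** * From dominance to ancestry by the low-high order *)

Variable o : seq V.
Hypothesis preT : preorder T o.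
Hypothesis lowT : low_high A s T o.

(** Only [s] dominates [s], and [s] is the root, an ancestor of everything. *)
Let nancestor_neq_start v w : ~~ ancestor T v w -> dominates A s v w -> w != s.
Proof.
move=> nvw; apply/contraPneq=> ws /(_ [::] isT (esym ws)).
rewrite inE => /eqP vs; move: nvw.
by rewrite vs -parent_property_root ancestor_root.
Qed.

Let nancestor_neq v w : ~~ ancestor T v w -> v != w.
Proof. by apply: contraNneq => ->; exact: ancestor_refl. Qed.

Lemma before_not_dominated v w : index w o < index v o -> ~ dominates A s v w.
Proof.
have [n] := ubnP (index w o); elim: n w => // n IHn w ltwn ltwv dvw.
have nvw : ~~ ancestor T v w.
  by apply: contraTN ltwv => /(ancestor_index preT); rewrite -leqNgt.
have step u : A u w -> index u o < index w o -> False.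
  move=> uw ltuw; apply: (IHn u).
  - exact: leq_trans ltuw ltwn.
  - exact: ltn_trans ltuw ltwv.
  - exact: dominates_pred uw (nancestor_neq nvw) dvw.
have /eqP nws := nancestor_neq_start nvw dvw.
have [[u /(tree_parent_index preT) ltuw uw]|] := lowT nws; first exact: step ltuw.
by case=> u [x [uw _ /and3P[_ _ ltuw] _ _]]; exact: step ltuw.
Qed.

(* The induction is on the last descendant [x] of [w], then on [w] itself, that
   is, on reverse postorder. *)
Lemma after_not_dominated v w : index v o < index w o -> ~~ ancestor T v w ->
  ~ dominates A s v w.
Proof.
(* Here [x] stays fixed while [w] climbs to its parent, and [k] bounds the number of positions from
   [x] to the end of [o]. *)
suff main k x : forall w, ancestor T w x -> size o <= index x o + k ->
    index v o < index w o -> ~~ ancestor T v w -> ~ dominates A s v w.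
  by apply: (main (size o) w); rewrite ?leq_addl ?ancestor_refl.
elim: k x => [|k IHk] x {}w.
  move=> /andP[xT _]; rewrite addn0 leqNgt index_mem.
  by have [_ -> _] := preT; rewrite xT.
have [n] := ubnP (index w o); elim: n w => // n IHn w ltwn wx lex ltvw nvw dvw.
have pdom u uw := @dominates_pred V A s v u w uw (nancestor_neq nvw) dvw.
have /eqP nws := nancestor_neq_start nvw dvw.
have [[u wu uw]|[_ [y [_ yw _ /and3P[_ _ ltwy] nwy]]]] := lowT nws.
  have nvu : ~~ ancestor T v u by apply: contra nvw; apply: ancestor_parent.
  have [ltuv|ltvu|equv] := ltngtP (index u o) (index v o).
  - exact: before_not_dominated ltuv (pdom u uw).
  - apply: (IHn u) (pdom u uw) => //.
      exact: leq_trans (tree_parent_index preT wu) ltwn.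
    exact: ancestor_trans (parent_ancestor wu) wx.
  - by move: (nancestor_neq nvu); rewrite (preorder_index_inj preT _ _ equv) ?eqxx.
(* The upper arc comes from beyond the whole subtree of [w], hence beyond [x], so [k] decreases. *)
have ltxy := descendant_lt_after preT (inT w) wx nwy ltwy.
apply: (IHk y y) (pdom y yw) => //; first exact: ancestor_refl.
- by apply: leq_trans lex _; rewrite addnS -addSn leq_add2r.
- exact: ltn_trans ltvw ltwy.
(* The subtree of [v] ends before [w], and [y] comes after [w]. *)
- apply/negP=> vy; have := descendant_lt_after preT (inT v) vy nvw ltvw.
  by rewrite ltnNge (ltnW ltwy).
Qed.

Lemma dominates_ancestor v w : dominates A s v w -> ancestor T v w.
Proof.
move=> dvw; apply/negPn/negP=> nvw.
have [ltwv|ltvw|eqwv] := ltngtP (index w o) (index v o).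
- exact: before_not_dominated dvw.
- exact: after_not_dominated dvw.
- by move: (nancestor_neq nvw); rewrite (preorder_index_inj preT _ _ eqwv) ?eqxx.
Qed.

End FlowGraphTree.

Theorem theorem9 (V : finType) (A : rel V) (s : V) (D T : rooted_tree V)
    (hG : flow_graph A s) (hD : is_dominator_tree A s D)
    (hpar : parent_property A T)
    (hlow : exists o : seq V, preorder T o /\ low_high A s T o) :
  sibling_property A s T /\ T = D.
Proof.
case: hlow => o [preT lowT]; case: hD => DV Ds Ddom.
have domT v w := @dominates_ancestor V A s T hG hpar o preT lowT v w.
have TV := parent_property_verts hG hpar.
have Ts := parent_property_root hG hpar.
have ancE v w : ancestor D v w = ancestor T v w.
  apply/idP/idP => [/Ddom|vw]; first exact: domT.
  exact/Ddom/(ancestor_dominates hG hpar vw).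
(* A sibling [v] dominating [w] would be an ancestor of the common parent [u], which precedes
   [v]. *)
split=> [v w [/eqP nvw [u [vu wu]]] /domT vw|].
  have := ancestor_index preT (ancestor_parent_inv vw nvw wu).
  by rewrite leqNgt (tree_parent_index preT vu).
apply: eq_rooted_tree; rewrite ?TV ?DV ?Ts ?Ds //; apply/ffunP=> w.
have := tree_parent_neqNone T w; rewrite TV Ts -Ds -DV -tree_parent_neqNone.
case wu: (tree_parent T w) => [u|]; case wx: (tree_parent D w) => [x|] // _.
(* Each of the two parents is a proper ancestor of [w] in the other tree too, hence an ancestor of
   the other parent. *)
congr Some; apply: (ancestor_anti preT).
  rewrite -ancE; apply: ancestor_parent_inv wx; last exact: tree_parent_neq wu.
  by rewrite ancE parent_ancestor.
apply: ancestor_parent_inv wu; last exact: tree_parent_neq wx.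
by rewrite -ancE parent_ancestor.
Qed.
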